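(* Let $(\Omega,d)$ be a separable metric space, let $\mu_0$ and $\mu$ be Borel probability measures on $\Omega$, and let $X_1,X_2,\ldots$ be iid with law $\mu$. Let $\mathbb G_n(\omega,t)=\sqrt n\,(F_{n,\omega}(t)-F_\omega^{\mu_0}(t))$ and $$T_n^{\mathrm{KS}}=\sup_{\omega\in\Omega,t\ge0}|\mathbb G_n(\omega,t)|,\qquad T_n^{\mathrm{CM}}=\int_{\Omega\times\mathbb R_{\ge0}}\mathbb G_n(\omega,t)^2\,\mathrm dF_{n,\omega}(t)\,\mathrm dP_n(\omega).$$ Under the fixed alternative $H_1:\mu\neq\mu_0$, $T_n^{\mathrm{KS}}$ diverges to infinity in outer probability as $n\to\infty$. Moreover, under $H_1$, $T_n^{\mathrm{CM}}$ also diverges to infinity in outer probability if $\mu$ and $\mu_0$ satisfy the doubling condition (condition (a2) in the context), or if there is $\alpha>0$ such that $(\Omega,d^\alpha)$ is of strong negative type (condition (a1) in the context) and $\mathrm{supp}(\mu_0)\subset\mathrm{supp}(\mu)$.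
   Context: For a Borel probability measure $\nu$ on $\Omega$, the distance profile of $\nu$ at $\omega$ is $F_\omega^\nu(t)=\nu(\{x:d(\omega,x)\le t\})$, $t\ge0$. The empirical profile is $F_{n,\omega}(t)=\frac1n\sum_{i=1}^n1_{\{d(\omega,X_i)\le t\}}$ and $P_n=\frac1n\sum_{i=1}^n\delta_{X_i}$, so $T_n^{\mathrm{CM}}=n^{-2}\sum_{i,j=1}^n\mathbb G_n(X_i,d(X_i,X_j))^2$. $\mathrm{supp}(\nu)$ is the closure of the set of points all of whose open neighborhoods have positive $\nu$-mass. $T_n$ diverges to infinity in outer probability if $\mathsf P^*(T_n\le K)\to0$ for every $K<\infty$, with $\mathsf P^*$ the outer probability. Standing assumptions: (b1) $\varepsilon\log N(\varepsilon,\Omega,d)\to0$ as $\varepsilon\to0^+$, with $N(\varepsilon,\Omega,d)$ the covering number. (b2') for $\nu\in\{\mu,\mu_0\}$ there is $K_\nu>0$ with $\sup_{\omega\in\Omega}|F_\omega^\nu(r)-F_\omega^\nu(s)|\le K_\nu|r-s|$ for all $r,s\ge0$. At least one of: (a1) there is $\alpha>0$ such that $(\Omega,d^\alpha)$ is of strong negative type (negative type, and $\iint d^\alpha(x,y)\,\mathrm d(\nu_1-\nu_2)(x)\,\mathrm d(\nu_1-\nu_2)(y)=0$ only if $\nu_1=\nu_2$, for Borel probability measures with finite first moment with respect to $d^\alpha$); (a2) the probability measures $\nu\in\{\mu,\mu_0\}$ satisfy the doubling condition: there is $L_\nu<\infty$ with $\limsup_{r\to0^+}\nu(B(\omega,2r))/\nu(B(\omega,r))\le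 L_\nu$ for every $\omega\in\mathrm{supp}(\nu)$. *)

(* Defs.v *)
From HB Require Import structures.
From mathcomp Require Import all_boot all_order all_algebra.
From mathcomp Require Import all_classical all_reals all_analysis.
From mathcomp Require giry.

Set Implicit Arguments.
Unset Strict Implicit.
Unset Printing Implicit Defensive.

Import Order.TTheory GRing.Theory Num.Theory.
Import numFieldNormedType.Exports.

Local Open Scope classical_set_scope.
Local Open Scope ring_scope.

(* The base point is only there because [measurableType] requires one; a metric
   space carrying a probability measure is nonempty anyway. *)
#[short(type="pmetricType")]
HB.structure Definition PointedMetric (R : numDomainType) :=
  {T of Pointed T & Metric R T}.

Definition separable (T : topologicalType) : Prop :=
  exists D : set T, countable D /\ dense D.

Section metric_measure.
Context {R : realType} (Omega : pmetricType R).

Definition borel : measurableType (sigma_display (@open Omega)) :=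
  g_sigma_algebraType (@open Omega).

Definition covering_number (e : R) : \bar R :=
  ereal_inf [set (size s)%:R%:E | s in
    [set s : seq Omega | [set: Omega] `<=` \bigcup_(x in [set` s]) ball x e]].

(* [lne +oo = +oo], so this forces the covering numbers to be finite. *)
Definition entropy_condition : Prop :=
  (e%:E * lne (covering_number e))%E @[e --> 0^'+] --> 0%E.

Definition negative_type (rho : Omega -> Omega -> R) : Prop :=
  forall (n : nat) (x : 'I_n -> Omega) (c : 'I_n -> R),
    \sum_(i < n) c i = 0 ->
    \sum_(i < n) \sum_(j < n) c i * c j * rho (x i) (x j) <= 0.

Definition finite_first_moment (rho : Omega -> Omega -> R)
    (nu : probability borel R) : Prop :=
  exists o : Omega, (\int[nu]_x (rho o x)%:E < +oo)%E.

Definition energy (rho : Omega -> Omega -> R)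
    (nu1 nu2 : probability borel R) : R :=
  fine (\int[nu1]_x \int[nu2]_y (rho x y)%:E)%E.

(* The integral of [rho] against [(nu1 - nu2) (x) (nu1 - nu2)], expanded by
   bilinearity; the four terms are finite under the moment conditions.
   [giry.measure_eq] is equality on measurable sets. *)
Definition strong_negative_type (rho : Omega -> Omega -> R) : Prop :=
  negative_type rho /\
  forall nu1 nu2 : probability borel R,
    finite_first_moment rho nu1 -> finite_first_moment rho nu2 ->
    energy rho nu1 nu1 - energy rho nu1 nu2
      - energy rho nu2 nu1 + energy rho nu2 nu2 = 0 ->
    giry.measure_eq nu1 nu2.

Definition some_power_strong_negative_type : Prop :=
  exists alpha : R, 0 < alpha /\
    strong_negative_type (fun x y => mdist x y `^ alpha).

Definition supp (nu : probability borel R) : set Omega :=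
  closure [set w | forall U : set Omega, open U -> U w -> (0 < nu U)%E].

Definition doubling (nu : probability borel R) : Prop :=
  exists L : R, forall w : Omega, supp nu w ->
    (limf_esup (fun r : R => nu (ball w (2 * r)) / nu (ball w r)) 0^'+
       <= L%:E)%E.

Definition profile (nu : probability borel R) (w : Omega) (t : R) : R :=
  fine (nu [set x : Omega | mdist w x <= t]).

Definition lipschitz_profile (nu : probability borel R) : Prop :=
  exists K : R, 0 < K /\ forall r s : R, 0 <= r -> 0 <= s ->
    (ereal_sup [set `|profile nu w r - profile nu w s|%:E | w in [set: Omega]]
       <= (K * `|r - s|)%:E)%E.

(* Samples are indexed from 0: [X_1, ..., X_n] is [x 0, ..., x n.-1]. *)
Definition empirical_profile (n : nat) (x : nat -> Omega) (w : Omega) (t : R)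
    : R :=
  n%:R^-1 * \sum_(i < n) (mdist w (x i) <= t)%R%:R.

Definition empirical_process (mu0 : probability borel R) (n : nat)
    (x : nat -> Omega) (w : Omega) (t : R) : R :=
  Num.sqrt n%:R * (empirical_profile n x w t - profile mu0 w t).

Definition T_KS (mu0 : probability borel R) (n : nat) (x : nat -> Omega)
    : \bar R :=
  ereal_sup [set `|empirical_process mu0 n x p.1 p.2|%:E | p in
    [set p : Omega * R | 0 <= p.2]].

Definition empirical_measure d (T : measurableType d) (n : nat) (x : nat -> T)
    : {measure set T -> \bar R} :=
  mscale (n%:R^-1)%:nng (msum (fun i => \d_(x i)) n).

(* The measure [dF_{n,w}], with distribution function [F_{n,w}], is the
   empirical measure of the distances from [w] to the sample. *)
Definition T_CM (mu0 : probability borel R) (n : nat) (x : nat -> Omega)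
    : \bar R :=
  \int[@empirical_measure _ borel n x]_w
    \int[@empirical_measure _ (measurableTypeR R) n (fun i => mdist w (x i))]_(t in `[0%R, +oo[)
      (empirical_process mu0 n x w t ^+ 2)%:E.

End metric_measure.

Section probability_notions.
Context {R : realType} d d' (W : measurableType d) (T : measurableType d').
Context (P : probability W R).

Definition mutually_independent (X : nat -> {RV P >-> T}) : Prop :=
  forall (s : seq nat) (A : nat -> set T), uniq s ->
    (forall i, measurable (A i)) ->
    P (\bigcap_(i in [set` s]) (X i @^-1` A i)) =
      (\prod_(i <- s) P (X i @^-1` A i))%E.

Definition iid_with_law (X : nat -> {RV P >-> T}) (mu : probability T R)
    : Prop :=
  mutually_independent X /\ forall i, giry.measure_eq (distribution P (X i)) mu.

Definition diverges_in_outer_probability (Y : nat -> W -> \bar R) : Prop :=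
  forall K : R,
    (P^*)%mu [set w | (Y n w <= K%:E)%E] @[n --> \oo] --> 0%E.

End probability_notions.

(* Main.v *)
Require Import Defs.
From mathcomp Require Import all_boot all_order all_algebra.
From mathcomp Require Import all_classical all_reals all_analysis.
From mathcomp Require giry.
From mathcomp Require Import measurable_realfun ring lra.

(** The statistics grow like [sqrt n] times a difference of profiles, respectively
    [n] times squares of such differences, so each diverges as soon as one
    well-chosen difference [profile mu w0 t0 - profile mu0 w0 t0] is nonzero.  The
    only probabilistic input is the concentration of finitely many empirical
    frequencies (Chebyshev's inequality, [frequency_tail]).

    For [T_KS] this is immediate ([T_KS_diverges]): the supremum dominates
    [sqrt n] times the deviation at the single pair [(w0, t0)].

    For [T_CM] the pair [(w0, t0)] has to be visited by the sample: [w0] must lie in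
    the support of [mu], and [t0] in the support of the law of the distance to [w0]
    ([charged_gap]).  The distribution functions are monotone in the radius, and
    moving the centre by [eta] costs at most [eta] in the radius; so one deviation
    bound at [(w0, s)], with [s] next to [t0], separates the empirical profile from
    that of [mu0] on a whole neighbourhood of [(w0, t0)]
    ([separation_window]).  A positive fraction of the pairs [(X_i, d(X_i, X_j))]
    falls into that neighbourhood, whence a lower bound on [T_CM] which is linear
    in [n] ([T_CM_lower_bound]).

    It remains to see that two measures whose profiles agree on the support of [mu]
    are equal.  With strong negative type of [d^alpha], equal profiles at [w] give
    equal integrals of [d(w, .)^alpha]; integrating over [w] makes the energy
    distance vanish, provided that the set of such centres [w] has full measure for
    both laws ([strong_negative_type_determines]).  When [mu] is doubling
    ([doubling_determines]), a Vitali type argument fills open sets, up to small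
    [mu]-measure, with disjoint closed balls centred in the support: as the two
    measures agree on these balls, [mu <= mu0] on open sets.  The
    entropy condition enters through total boundedness, which makes all these
    coverings finite. *)

Set Implicit Arguments.
Unset Strict Implicit.
Unset Printing Implicit Defensive.

Import Order.TTheory GRing.Theory Num.Theory.
Import numFieldNormedType.Exports.

Local Open Scope classical_set_scope.
Local Open Scope ring_scope.

(** * Metric balls and total boundedness *)

Section metric_borel.
Context (R : realType) (Omega : pmetricType R).
Implicit Types (w x y : Omega) (r t : R) (U : set Omega).

Lemma ball_mdistP w r x : ball w r x <-> mdist w x < r.
Proof. by rewrite ballEmdist. Qed.

Lemma open_mdist_sub U x : open U -> U x ->
  exists2 e, 0 < e & forall y, mdist x y < e -> U y.
Proof.
move=> oU Ux; have /nbhs_ballP[e /= e0 eU] : nbhs x U by exact: open_nbhs_nbhs.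
by exists e => // y xy; apply: eU; apply/ball_mdistP.
Qed.

Lemma open_of_mdist U :
  (forall x, U x -> exists2 e, 0 < e & forall y, mdist x y < e -> U y) ->
  open U.
Proof.
move=> h; rewrite openE => x Ux; have [e e0 eU] := h x Ux.
by apply/nbhs_ballP; exists e => //= y /ball_mdistP; exact: eU.
Qed.

Lemma open_metric_ball w r : open (ball w r).
Proof.
apply: open_of_mdist => x /ball_mdistP wx; exists (r - mdist w x).
  by rewrite subr_gt0.
move=> y xy; apply/ball_mdistP; have := metric_triangle w x y; lra.
Qed.

Definition cball w t : set Omega := [set x | mdist w x <= t].

Lemma open_setC_cball w t : open (~` cball w t).
Proof.
apply: open_of_mdist => x /negP; rewrite /= -ltNge => wx.
exists (mdist w x - t); first by rewrite subr_gt0.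
move=> y xy; apply/negP; rewrite -ltNge.
have := metric_triangle w y x; rewrite (metric_sym y x); lra.
Qed.

Lemma open_borel U : open U -> measurable (U : set (borel Omega)).
Proof. by move=> oU; apply: sub_sigma_algebra. Qed.

Lemma closed_borel U : closed U -> measurable (U : set (borel Omega)).
Proof.
move=> cU; rewrite -[U]setCK; apply: measurableC.
by apply: open_borel; rewrite openC.
Qed.

Lemma cball_borel w t : measurable (cball w t : set (borel Omega)).
Proof.
rewrite -[cball w t]setCK; apply: measurableC.
by apply: open_borel; exact: open_setC_cball.
Qed.

Lemma ball_borel w r : measurable (ball w r : set (borel Omega)).
Proof. by apply: open_borel; exact: open_metric_ball. Qed.

Definition totally_bounded : Prop := forall e, 0 < e ->
  exists s : seq Omega, forall x, exists2 y, y \in s & mdist y x < e.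

(** If no finite cover existed at some scale, the covering number would be
    infinite at all smaller scales, and so would its product with the radius. *)
Lemma entropy_totally_bounded : entropy_condition Omega -> totally_bounded.
Proof.
move=> H e e0.
have : \forall r \near (0:R)^'+, (r%:E * lne (covering_number Omega r) < 1%:E)%E.
  have /= := H; move/(_ [set z | (z < 1%:E)%E]); apply.
  by apply: open_nbhs_nbhs; split; [exact: open_ereal_lt_ereal|rewrite /= lte_fin].
move=> H1.
near (0:R)^'+ => r.
have r0 : 0 < r by near: r; exact: nbhs_right_gt.
have re : r < e by near: r; exact: nbhs_right_lt.
have Hr : (r%:E * lne (covering_number Omega r) < 1%:E)%E by near: r.
have [[s Hs]|Hs] := pselect (exists s : seq Omega,
    [set: Omega] `<=` \bigcup_(x in [set` s]) ball x r).
  exists s => x; have [y /= ys /ball_mdistP yx] := Hs x I.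
  by exists y => //; apply: lt_trans re.
exfalso; move: Hr; rewrite /covering_number (_ : image _ _ = set0) ?ereal_inf0.
  by rewrite /= gt0_muley ?lte_fin.
by rewrite -subset0 => z [s hs _]; apply: Hs; exists s.
Unshelve. all: by end_near. Qed.

Lemma totally_bounded_bounded : totally_bounded ->
  exists M : R, 0 < M /\ forall x y, mdist x y <= M.
Proof.
move=> /(_ 1 ltr01) [s Hs].
have [M [M0 HM]] : exists M : R, 0 <= M /\ forall y, y \in s -> mdist point y <= M.
  elim: (s) => [|a s' [M [M0 IH]]]; first by exists 0.
  exists (Num.max M (mdist point a)); split; first by rewrite le_max M0.
  move=> y; rewrite inE le_max => /orP[/eqP->|/IH->//]; by rewrite lexx orbT.
have H x : mdist point x <= M + 1.
  have [y /HM ys yx] := Hs x; have := metric_triangle point y x; lra.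
exists (M + 1 + (M + 1)); split; first lra.
move=> x y; have := metric_triangle x point y; rewrite (metric_sym x point).
have := H x; have := H y; lra.
Qed.

(** A greedy choice along a finite cover by balls of radius [r]: each of these balls
    contributes at most one point, since it is swallowed by the ball of radius
    [2 * r] around any of its own points.  The separation [2 * r] is what makes the
    closed balls of radius [r] around the chosen points disjoint. *)
Lemma separated_net (A : set Omega) r : 0 < r -> totally_bounded ->
  exists s : seq Omega, [/\ {in s, forall x, A x},
    pairwise (fun x y => 2 * r < mdist x y) s &
    forall y, A y -> exists2 x, x \in s & mdist x y <= 2 * r].
Proof.
move=> r0 /(_ r r0)[s cov].
have {cov} : forall x, A x -> exists2 y, y \in s & mdist y x < r by [].
elim: s A => [|a s IH] A cov.
  by exists [::]; split => // y /cov[].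
have [[x [Ax ax]]|hx] := pselect (exists x, A x /\ mdist a x < r); last first.
  apply: IH => x Ax; have [y] := cov x Ax; rewrite inE => /orP[/eqP->|ys yx].
    by move=> ax; exfalso; apply: hx; exists x.
  by exists y.
have [|s' [s1 s2 s3]] := IH (A `&` [set z | 2 * r < mdist x z]).
  move=> z [Az xz]; have [y] := cov z Az; rewrite inE => /orP[/eqP->|ys yx].
    move=> az; exfalso; have := metric_triangle x a z.
    by rewrite (metric_sym x a); move: xz => /=; lra.
  by exists y.
exists (x :: s'); split.
- by move=> z; rewrite inE => /orP[/eqP->//|/s1 []].
- by rewrite pairwise_cons s2 andbT; apply/allP => z /s1 [].
- move=> y Ay; have [xy|xy] := leP (mdist x y) (2 * r).
    by exists x => //; rewrite mem_head.
  by have [//|z zs zy] := s3 y; exists z => //; rewrite inE zs orbT.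
Qed.

End metric_borel.

(** * Supports and the doubling condition *)

Lemma vanishing_radii (R : realType) : exists q : nat -> R,
  (forall k, 0 < q k) /\
  forall e, 0 < e -> exists k0, forall k, (k0 <= k)%N -> q k < e.
Proof.
exists (fun k => k.+1%:R^-1); split=> [k|e e0]; first by rewrite invr_gt0.
by have [k0 _ h] := near_infty_natSinv_lt (PosNum e0); exists k0.
Qed.

Section support.
Context (R : realType) (Omega : pmetricType R) (nu : probability (borel Omega) R).

Lemma supp_open w (U : set Omega) : supp nu w -> open U -> U w -> (0 < nu U)%E.
Proof.
move=> sw oU Uw; have [|v [/= vpos Uv]] := sw U; last exact: vpos.
exact: open_nbhs_nbhs.
Qed.

Lemma supp_borel : measurable (supp nu : set (borel Omega)).
Proof. by apply: closed_borel; exact: closed_closure. Qed.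

(** Every point off the support has a null neighbourhood, hence lies in a null ball
    of one of the countably many finite covers at scales [q k]. *)
Lemma measure_setC_supp : totally_bounded Omega -> nu (~` supp nu) = 0%E.
Proof.
move=> tb; have [q [q0 qe]] := vanishing_radii R.
have /choice[s Hs] : forall k : nat, exists s : seq Omega,
    forall x, exists2 y, y \in s & mdist y x < q k.
  by move=> k; apply: tb.
pose N k := \big[setU/set0]_(y <- s k | nu (ball y (q k)) == 0%E)
  (ball y (q k) : set (borel Omega)).
have mN k : measurable (N k).
  by apply: bigsetU_measurable => y _; exact: ball_borel.
have N0 k : nu (N k) = 0%E.
  rewrite /N; elim: (s k) => [|y t IH]; rewrite ?big_nil ?measure0// big_cons.
  case: ifPn => // /eqP y0; rewrite null_set_setU//; first exact: ball_borel.
  by apply: bigsetU_measurable => z _; exact: ball_borel.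
suff : ~` supp nu `<=` \bigcup_k N k.
  move=> sN; have : nu.-negligible (~` supp nu).
    apply: (@negligibleS _ _ _ nu (\bigcup_k N k) (~` supp nu) sN).
    apply: negligible_bigcup => k. by exists (N k); split; [exact: mN|exact: N0|].
  move=> [A [mA A0 sA]]; apply: (subset_measure0 _ mA sA A0).
  by apply: measurableC; exact: supp_borel.
move=> x sx.
have [U [oU Ux U0]] : exists U : set Omega, [/\ open U, U x & nu U = 0%E].
  apply: contrapT => h; apply: sx; apply: subset_closure => U oU Ux.
  rewrite lt0e measure_ge0 andbT; apply/eqP => U0; apply: h.
  by exists U.
have [e e0 eU] := open_mdist_sub oU Ux.
have [k /(_ k (leqnn k)) ke] := qe (e / 2) (divr_gt0 e0 (ltr0n _ 2)).
have [y ys yx] := Hs k x.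
exists k => //; rewrite /N -bigcup_seq_cond; exists y => /=; last exact/ball_mdistP.
rewrite ys /=; apply/eqP; apply: (@subset_measure0 _ _ _ nu _ U) => //.
- exact: ball_borel.
- exact: open_borel.
- move=> z /ball_mdistP yz; apply: eU; have := metric_triangle x y z.
  rewrite (metric_sym x y); lra.
Qed.

(** Real form of the doubling condition; the scale [r0] below which it holds
    depends on the point, only the constant is uniform. *)
Lemma doubling_ratio : doubling nu -> exists2 L : R, 0 < L &
  forall w, supp nu w -> exists2 r0, 0 < r0 & forall r, 0 < r -> r < r0 ->
    fine (nu (ball w (2 * r))) <= L * fine (nu (ball w r)).
Proof.
move=> [L HL]; exists (`|L| + 1); first by rewrite ltr_wpDl.
move=> w sw; have := HL w sw.
rewrite limf_esupE => Hle.
have : (ereal_inf [set ereal_sup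
   ((fun r : R => nu (ball w (2 * r)) / nu (ball w r))%E @` V) | V in 0^'+]
     < (`|L| + 1)%:E)%E.
  apply: le_lt_trans Hle _; rewrite lte_fin.
  by rewrite (le_lt_trans (ler_norm L))// ltrDl.
move=> /ereal_inf_lt[_ [V V0 <-]] HV.
have [r0 /= r00 Hr0] := V0.
exists r0 => // r rpos rr0.
have Vr : V r.
  by apply: Hr0 => //=; rewrite sub0r normrN gtr0_norm.
have : (nu (ball w (2 * r)) / nu (ball w r) < (`|L| + 1)%:E)%E.
  by apply: le_lt_trans HV; apply: ereal_sup_ubound; exists r.
have b0 : (0 < nu (ball w r))%E.
  apply: (supp_open sw (open_metric_ball w r)).
  by apply/ball_mdistP; rewrite mdistxx.
have f1 : nu (ball w r) \is a fin_num by apply: fin_num_measure; exact: ball_borel.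
have f2 : nu (ball w (2 * r)) \is a fin_num.
  by apply: fin_num_measure; exact: ball_borel.
move: b0; rewrite -(fineK f1) -(fineK f2) lte_fin => b0.
by rewrite inver gt_eqF// -EFinM lte_fin ltr_pdivrMr// => /ltW.
Qed.

End support.

(** * Exhausting open sets by disjoint balls *)

Section covering.
Context (R : realType) (Omega : pmetricType R).
Hypothesis tb : totally_bounded Omega.
Local Notation m P A := (fine (P (A : set (borel Omega)))).

Lemma measure_union_cballs (P : probability (borel Omega) R) (s : seq Omega) r :
  pairwise (fun x y => 2 * r < mdist x y) s ->
  P (\big[setU/set0]_(x <- s) (cball x r : set (borel Omega)))
   = (\sum_(x <- s) P (cball x r))%E.
Proof.
elim: s => [|x s IH]; first by rewrite !big_nil measure0.
rewrite pairwise_cons => /andP[/allP xs /IH h]; rewrite !big_cons.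
rewrite -h; apply: measureU; first exact: cball_borel.
- by apply: bigsetU_measurable => y _; exact: cball_borel.
- rewrite -subset0 => y [/= xy]; rewrite -bigcup_seq => -[z /= /xs xz zy].
  have := metric_triangle x y z; rewrite (metric_sym y z); move: xz xy zy.
  rewrite /cball /=; lra.
Qed.

Lemma measure_union_le (P : probability (borel Omega) R) (s : seq Omega)
    (F : Omega -> set (borel Omega)) :
  (forall x, measurable (F x)) ->
  (P (\big[setU/set0]_(x <- s) F x) <= \sum_(x <- s) P (F x))%E.
Proof.
move=> mF; elim: s => [|x s IH]; first by rewrite !big_nil measure0.
rewrite !big_cons; apply: (@le_trans _ _ (P (F x) + P (\big[setU/set0]_(x <- s) F x))%E).
  by apply: measureU2 => //; exact: bigsetU_measurable.
by rewrite leeD2l.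
Qed.

Lemma measure_setI_full (P : probability (borel Omega) R) (A B : set (borel Omega)) :
  measurable A -> measurable B -> P (~` B) = 0%E -> P (A `&` B) = P A.
Proof.
move=> mA mB B0; rewrite -[in RHS](setIT A) -(setUv B) setIUr measureU.
- rewrite [X in (_ + X)%E](_ : _ = 0%E) ?adde0//.
  apply: (subset_measure0 _ _ (@subIsetr _ A (~` B)) B0).
  + by apply: measurableI => //; exact: measurableC.
  + exact: measurableC.
- exact: measurableI.
- by apply: measurableI => //; exact: measurableC.
- by rewrite setIACA setICr setI0.
Qed.

Lemma fine_measure_le (P : probability (borel Omega) R) (A B : set (borel Omega)) :
  measurable A -> measurable B -> A `<=` B -> m P A <= m P B.
Proof.
by move=> mA mB AB; rewrite fine_le ?fin_num_measure// le_measure ?inE.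
Qed.

Lemma fine_measureD (P : probability (borel Omega) R) (A B : set (borel Omega)) :
  measurable A -> measurable B -> B `<=` A -> m P (A `\` B) = m P A - m P B.
Proof.
move=> mA mB BA; rewrite measureD//; last by rewrite ltey_eq fin_num_measure.
by rewrite setIidr// fineB ?fin_num_measure.
Qed.

(** Fatou's lemma for sets, in the form of an index that already captures any mass
    below that of [U]. *)
Lemma measure_liminf (P : probability (borel Omega) R)
    (V : nat -> set (borel Omega)) (U : set (borel Omega)) (c : R) :
  (forall k, measurable (V k)) -> measurable U ->
  (forall x, U x -> exists k0, forall k, (k0 <= k)%N -> V k x) ->
  c < m P U -> exists k, c <= m P (V k).
Proof.
move=> mV mU UV cU; apply: contrapT => h.
pose W k := \bigcap_(j in [set j | (k <= j)%N]) V j.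
have mW k : measurable (W k) by apply: bigcap_measurableType => j _.
have mWW : measurable (\bigcup_k W k) by apply: bigcupT_measurable.
have UW : U `<=` \bigcup_k W k.
  by move=> x /UV[k0 hk]; exists k0 => // j /= /hk.
have : (P (\bigcup_k W k) <= c%:E)%E.
  have cv : P \o W @ \oo --> P (\bigcup_k W k).
    apply: nondecreasing_cvg_mu => //.
    move=> i j ij; apply/subsetPset => x Wx l /= jl.
    by apply: Wx => /=; exact: leq_trans jl.
  rewrite -(cvg_lim _ cv)//; apply: lime_le; first by apply/cvg_ex; exists (P (\bigcup_k W k)).
  apply: nearW => k /=.
  have mk : m P (V k) < c by rewrite ltNge; apply/negP => hk; apply: h; exists k.
  apply: (@le_trans _ _ (P (V k))).
    by rewrite le_measure ?inE// => x Wx; apply: (Wx k) => /=.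
  by rewrite -(fineK (fin_num_measure P _ (mV k))) lee_fin ltW.
have : (P U <= P (\bigcup_k W k))%E by rewrite le_measure ?inE.
by move=> /le_trans /[apply]; rewrite -(fineK (fin_num_measure P _ mU)) lee_fin leNgt cU.
Qed.

(** The core of the Vitali argument.  At scale [q k] consider the points [A k] of
    the support at which doubling already holds up to scale [2 * q k] and whose
    ball of radius [4 * q k] stays in [U].  A maximal separated family in [A k] has
    disjoint balls of radius [q k], while its balls of radius [4 * q k] cover
    [A k] and have at most [L ^+ 2] times the total mass.  Every point of the
    support in [U] belongs to [A k] for large [k], so for some [k] these larger
    balls carry at least half of the mass of [U]. *)
Lemma disjoint_balls_exhaust (P : probability (borel Omega) R) (L : R) (U : set Omega) :
  0 < L ->
  (forall w, supp P w -> exists2 r0, 0 < r0 & forall r, 0 < r -> r < r0 ->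
     m P (ball w (2 * r)) <= L * m P (ball w r)) ->
  open U -> 0 < m P U ->
  exists (s : seq Omega) (r : R),
    [/\ {in s, forall x, supp P x}, pairwise (fun x y => 2 * r < mdist x y) s,
        {in s, forall x, cball x r `<=` U} &
        m P U <= 2 * L ^+ 2 * m P (\big[setU/set0]_(x <- s) cball x r)].
Proof.
move=> L0 HL oU U0; have [q [q0 qe]] := vanishing_radii R.
pose A k : set Omega := [set x | [/\ supp P x, ball x (4 * q k) `<=` U &
   forall r, 0 < r -> r <= 2 * q k -> m P (ball x (2 * r)) <= L * m P (ball x r)]].
have /choice[s Hs] : forall k, exists s : seq Omega,
   [/\ {in s, forall x, A k x},
    pairwise (fun x y => 2 * q k < mdist x y) s &
    forall y, A k y -> exists2 x, x \in s & mdist x y <= 2 * q k].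
  by move=> k; apply: separated_net.
pose V k : set (borel Omega) :=
  \big[setU/set0]_(x <- s k) (ball x (4 * q k) : set (borel Omega)).
have mV k : measurable (V k).
  by apply: bigsetU_measurable => x _; exact: ball_borel.
have mU := open_borel oU; have mS := supp_borel P.
have PUS : P (U `&` supp P) = P U.
  by apply: measure_setI_full => //; exact: measure_setC_supp.
have [k hk] : exists k, m P (U `&` supp P) / 2 <= m P (V k).
  apply: (@measure_liminf _ _ (U `&` supp P)) => //; [exact: measurableI| |by rewrite PUS; lra].
  move=> x [Ux Sx].
  have [e e0 eU] := open_mdist_sub oU Ux.
  have [r0 r00 hr0] := HL x Sx.
  have [k1 hk1] := qe (e / 4) (divr_gt0 e0 (ltr0n _ 4)).
  have [k2 hk2] := qe (r0 / 2) (divr_gt0 r00 (ltr0n _ 2)).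
  exists (maxn k1 k2) => k; rewrite geq_max => /andP[/hk1 ke /hk2 kr].
  have Ax : A k x.
    split => //; first by move=> y /ball_mdistP xy; apply: eU; lra.
    by move=> r rpos rq; apply: hr0 => //; lra.
  have [_ _ /(_ x Ax)[y ys yx]] := Hs k.
  rewrite /V -bigcup_seq; exists y => //=; apply/ball_mdistP.
  have := q0 k; lra.
move: hk; rewrite PUS => hk.
have [sA sep _] := Hs k.
exists (s k), (q k); split => //.
- by move=> x /sA [].
- move=> x /sA [_ xU _] y xy; apply: xU; apply/ball_mdistP; move: xy (q0 k); rewrite /cball /=; lra.
- have fsum F : (forall x, measurable (F x)) ->
      fine (\sum_(x <- s k) P (F x : set (borel Omega)))%E = \sum_(x <- s k) m P (F x).
    move=> mF; rewrite -sum_fine// => x _; exact: fin_num_measure.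
  have mb x : measurable (cball x (q k) : set (borel Omega)) by exact: cball_borel.
  have mb4 x : measurable (ball x (4 * q k) : set (borel Omega)) by exact: ball_borel.
  have h1 : m P (V k) <= \sum_(x <- s k) m P (ball x (4 * q k)).
    rewrite -fsum// fine_le ?fin_num_measure//; last exact: measure_union_le.
    by rewrite sum_fin_num; apply/allP => ? /mapP[x _ ->]; exact: fin_num_measure.
  have h2 : \sum_(x <- s k) m P (ball x (4 * q k)) <= L ^+ 2 * \sum_(x <- s k) m P (cball x (q k)).
    rewrite mulr_sumr big_seq [leRHS]big_seq; apply: ler_sum => x /sA [_ _ hx].
    have e1 := hx (2 * q k); have e2 := hx (q k).
    have e3 : m P (ball x (q k)) <= m P (cball x (q k)).
      apply: fine_measure_le; [exact: ball_borel|exact: cball_borel|].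
      by move=> y /ball_mdistP /ltW.
    have := q0 k => qk.
    have E : 4 * q k = 2 * (2 * q k) by lra.
    rewrite E; apply: (le_trans (e1 _ _)); [lra|lra|].
    rewrite expr2 -mulrA ler_pM2l//; apply: (le_trans (e2 _ _)); [lra|lra|].
    by rewrite ler_pM2l.
  rewrite (measure_union_cballs P sep) fsum//.
  rewrite -mulrA; lra.
Qed.

End covering.

(** * Profiles determine a doubling measure *)

Section determination.
Context (R : realType) (Omega : pmetricType R).
Implicit Types (mu nu : probability (borel Omega) R) (U : set Omega).
Hypothesis tb : totally_bounded Omega.
Local Notation m P A := (fine (P (A : set (borel Omega)))).

Lemma open_setD_cballs (s : seq Omega) r U :
  open U -> open (U `\` \big[setU/set0]_(x <- s) cball x r).
Proof.
elim: s U => [|x s IH] U oU; first by rewrite big_nil setD0.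
rewrite big_cons -setDDl; apply: IH; rewrite setDE; apply: openI => //.
exact: open_setC_cball.
Qed.

(** Removing from [U] disjoint balls carrying a fraction [c] of its mass, on which
    both measures agree, leaves the difference [mu U - nu U] unchanged and shrinks
    [mu U] by the factor [1 - c].  Iterating, [mu U - nu U] is at most
    [(1 - c) ^+ k * mu U] for every [k]. *)
Lemma le_open_of_profiles mu nu : doubling mu ->
  (forall w t, supp mu w -> profile mu w t = profile nu w t) ->
  forall U, open U -> m mu U <= m nu U.
Proof.
move=> /doubling_ratio[L L0 HL] prof.
(* the summand 1 only serves to make [c] smaller than 1 *)
pose c := (2 * L ^+ 2 + 1)^-1.
have D0 : 0 < 2 * L ^+ 2 + 1.
  by rewrite ltr_wpDl// mulr_ge0// exprn_ge0// ltW.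
have c0 : 0 < c by rewrite invr_gt0.
have c1 : c < 1.
  by rewrite invf_lt1// ltrDr mulr_gt0// exprn_gt0.
have fge0 (P : probability (borel Omega) R) A : 0 <= m P A by rewrite fine_ge0.
have Q k U : open U -> m mu U <= m nu U + (1 - c) ^+ k * m mu U.
  elim: k U => [|k IH] U oU; first by rewrite expr0 mul1r lerDr.
  have [U0|U0] := leP (m mu U) 0.
    have -> : m mu U = 0 by apply/eqP; rewrite eq_le U0 fge0.
    by rewrite mulr0 addr0.
  have [s [r [ssupp sep sU hU]]] := disjoint_balls_exhaust tb L0 HL oU U0.
  set C := \big[setU/set0]_(x <- s) _ in hU.
  have mC : measurable (C : set (borel Omega)).
    by apply: bigsetU_measurable => x _; exact: cball_borel.
  have mU := open_borel oU.
  have CU : C `<=` U by move=> y; rewrite /C -bigcup_seq => -[x /= xs]; exact: sU.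
  have muC : m mu C = m nu C.
    rewrite !(measure_union_cballs _ sep); congr fine.
    rewrite big_seq [in RHS]big_seq; apply: eq_bigr => x /ssupp Sx.
    have e := congr1 EFin (prof x r Sx); move: e; rewrite /profile -/(cball x r).
    by rewrite !fineK// fin_num_measure//; exact: cball_borel.
  have := IH _ (open_setD_cballs s r oU); rewrite -/C.
  rewrite !fine_measureD// muC => h.
  have hc : c * m mu U <= m nu C.
    by rewrite -muC mulrC ler_pdivrMr// mulrC; have := fge0 mu C; lra.
  have h2 : (1 - c) ^+ k * (m mu U - m nu C) <= (1 - c) ^+ k * ((1 - c) * m mu U).
    by rewrite ler_wpM2l ?exprn_ge0//; lra.
  rewrite exprSr -mulrA; lra.
move=> U oU; rewrite leNgt; apply/negP => d0.
have cv : (fun k => (1 - c) ^+ k) @ \oo --> (0 : R).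
  by apply: cvg_expr; rewrite ger0_norm; lra.
have [k _ /(_ k (leqnn k)) hk] : \forall k \near \oo, (1 - c) ^+ k < m mu U - m nu U.
  by apply: (cvgr_lt _ cv); rewrite subr_gt0.
have mU1 : m mu U <= 1.
  rewrite -lee_fin fineK ?probability_le1//; first exact: open_borel.
  by apply: fin_num_measure; exact: open_borel.
have := Q k U oU.
have : (1 - c) ^+ k * m mu U <= (1 - c) ^+ k * 1.
  by rewrite ler_wpM2l// exprn_ge0//; lra.
lra.
Qed.

(** An open set is the increasing union of the closed sets [F k] of points whose
    ball of radius [q k] stays inside; the complements of these are open, and
    passing to complements reverses the inequality. *)
Lemma eq_of_le_open mu nu : (forall U, open U -> m mu U <= m nu U) ->
  giry.measure_eq mu nu.
Proof.
move=> H.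
have ge U : open U -> m nu U <= m mu U.
  move=> oU; have mU := open_borel oU.
  have [q [q0 qe]] := vanishing_radii R.
  pose F k : set (borel Omega) := [set x | ball x (q k) `<=` U].
  have oF k : open (~` F k : set Omega).
    apply: open_of_mdist => x /= /existsNP[z /not_implyP[/ball_mdistP xz Uz]].
    exists (q k - mdist x z); first by rewrite subr_gt0.
    move=> y xy yU; apply: Uz; apply: yU; apply/ball_mdistP.
    have := metric_triangle y x z; rewrite (metric_sym y x); lra.
  have mF k : measurable (F k).
    by rewrite -(setCK (F k)); apply: measurableC; apply: open_borel; exact: oF.
  rewrite leNgt; apply/negP => lt_mu_nu.
  have cU : (m mu U + m nu U) / 2 < m nu U by lra.
  have UF x : U x -> exists k0, forall k, (k0 <= k)%N -> F k x.
    move=> Ux; have [e e0 eU] := open_mdist_sub oU Ux.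
    have [k0 hk0] := qe e e0; exists k0 => k /hk0 ke y /ball_mdistP xy.
    by apply: eU; lra.
  have [k hk] := measure_liminf mF mU UF cU.
  have := H _ (oF k); rewrite !probability_setC// !fineB ?fin_num_measure//=.
  have : m mu (F k) <= m mu U.
    apply: fine_measure_le => // x; apply; apply/ball_mdistP; rewrite mdistxx; exact: q0.
  lra.
move=> A mA; apply: (@measure_unique _ _ (borel Omega) (@open Omega) (fun=> setT)) => //.
- exact: openI.
- by move=> _; exact: openT.
- by rewrite bigcup_const.
- move=> U oU; suff : mu U = nu U by [].
  rewrite -(fineK (fin_num_measure mu _ (open_borel oU))).
  rewrite -(fineK (fin_num_measure nu _ (open_borel oU))).
  by congr EFin; apply/eqP; rewrite eq_le H// ge.
- by move=> _; suff : (mu setT < +oo)%E by []; rewrite probability_setT ltry.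
Qed.

Lemma doubling_determines mu nu : doubling mu ->
  (forall w t, supp mu w -> profile mu w t = profile nu w t) ->
  giry.measure_eq mu nu.
Proof. by move=> dm pr; apply: eq_of_le_open; exact: le_open_of_profiles. Qed.

End determination.

(** * Integrals without measurability assumptions *)

Section integral_off_null_set.
Context d (T : measurableType d) (R : realType) (P : {measure set T -> \bar R}).
Local Open Scope ereal_scope.
Import HBNNSimple.

(** The integral of a nonnegative function is a supremum over the simple functions
    below it, which are measurable even if [f] and [g] are not: a simple function
    below [f] can be set to zero off [S] without changing its integral, and is then
    below [g].  In the applications, [f] and [g] are inner integrals of the energy or
    of the Cramer-von Mises statistic, as functions of the centre. *)
Lemma le_integral_off_null (S : set T) (f g : T -> \bar R) :
  measurable S -> P (~` S) = 0 ->
  (forall x, 0 <= f x) -> (forall x, 0 <= g x) ->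
  (forall x, S x -> f x <= g x) ->
  \int[P]_x f x <= \int[P]_x g x.
Proof.
move=> mS S0 f0 g0 fg; rewrite !ge0_integralTE//.
apply: ge_ereal_sup => _ [h /= hf <-].
have h0 x : (0 <= h x)%R by exact: fun_ge0.
have -> : sintegral P h = sintegral P (proj_nnsfun h mS).
  have -> : sintegral P h = \int[P]_x (h x)%:E.
    by rewrite integral_nnsfun// patch_setT.
  rewrite (@ge0_negligible_integral _ _ _ P setT (~` S))//.
  - by rewrite setTD setCK integral_nnsfun// mrestrict.
  - exact: measurableC.
  - by apply/measurable_EFinP.
  - by move=> x _; rewrite lee_fin.
apply: ereal_sup_ubound; exists (proj_nnsfun h mS) => //= x.
have := congr1 (fun k => k x) (mrestrict h mS); rewrite patchE /= => <-.
case: ifPn => // xS; apply: (le_trans (hf x)); apply: fg; exact: set_mem.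
Qed.

Lemma eq_integral_off_null (S : set T) (f g : T -> \bar R) :
  measurable S -> P (~` S) = 0 ->
  (forall x, 0 <= f x) -> (forall x, 0 <= g x) ->
  (forall x, S x -> f x = g x) ->
  \int[P]_x f x = \int[P]_x g x.
Proof.
move=> mS S0 f0 g0 fg; apply/eqP; rewrite eq_le.
by rewrite !(@le_integral_off_null S)// => x Sx; rewrite fg.
Qed.

End integral_off_null_set.

(** * Profiles determine the measure under strong negative type *)

Section energy.
Context (R : realType) (Omega : pmetricType R).
Implicit Types (mu nu : probability (borel Omega) R).
Hypothesis tb : totally_bounded Omega.
Variable alpha : R.
Hypothesis alpha0 : 0 < alpha.

Let dpow (w x : Omega) : R := mdist w x `^ alpha.

Lemma dpow_gtE w (r : R) : 0 <= r ->
  [set x | r < dpow w x] = ~` cball w (r `^ alpha^-1).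
Proof.
move=> r0; have ai : 0 < alpha^-1 by rewrite invr_gt0.
have e y : 0 <= y -> (y `^ alpha^-1) `^ alpha = y.
  by move=> y0; rewrite -powRrM mulVf ?gt_eqF// powRr1.
apply/seteqP; split => x; rewrite /cball /dpow /=.
- move=> rx; apply/negP; rewrite -ltNge ltNge; apply/negP => h.
  move: rx; rewrite ltNge => /negP; apply; rewrite -(e r r0).
  by apply: ge0_ler_powR => //; rewrite ?nnegrE ?mdist_ge0 ?powR_ge0// ltW.
- move=> /negP; rewrite -ltNge => h; rewrite -(e r r0).
  by apply: gt0_ltr_powR => //; rewrite ?nnegrE ?mdist_ge0 ?powR_ge0.
Qed.

Lemma measurable_dpow w :
  measurable_fun setT (dpow w : borel Omega -> measurableTypeR R).
Proof.
apply: (measurability _ (RGenOInfty.measurableE R)) => /= _ [_ [r ->] <-].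
rewrite setTI; have [r0|r0] := leP 0 r.
  rewrite [X in measurable X](_ : _ = ~` cball w (r `^ alpha^-1)).
    by apply: measurableC; exact: cball_borel.
  by rewrite -dpow_gtE//; apply/seteqP; split => x /=; rewrite in_itv/= andbT.
rewrite [X in measurable X](_ : _ = setT)//.
apply/seteqP; split => x //= _; rewrite in_itv/= andbT.
by rewrite (lt_le_trans r0)// powR_ge0.
Qed.

(** By the tail formula, the integral of [d(w, .)^alpha] is the integral over
    [r >= 0] of the mass of the points at distance more than [r^(1/alpha)], which
    is a function of the profile. *)
Lemma integral_dpow_eq mu nu w : (forall t, profile mu w t = profile nu w t) ->
  (\int[mu]_x (dpow w x)%:E = \int[nu]_x (dpow w x)%:E)%E.
Proof.
move=> prof.
have mX := mem_set (measurable_dpow w) : (dpow w : borel Omega -> R) \in mfun.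
pose X : {mfun borel Omega >-> R} := mfun_Sub mX.
pose Xm : {RV mu >-> R} := X.
pose Xn : {RV nu >-> R} := X.
have X0 x : 0 <= dpow w x by exact: powR_ge0.
have := ge0_expectation_ccdf (P := mu) (X := Xm) X0.
have := ge0_expectation_ccdf (P := nu) (X := Xn) X0.
rewrite !expectation_def => -> ->.
apply: eq_integral => r; rewrite inE /= in_itv/= andbT => r0.
rewrite /ccdf /distribution /pushforward /=.
have -> : dpow w @^-1` `]r, +oo[ = ~` cball w (r `^ alpha^-1).
  by rewrite -dpow_gtE//; apply/seteqP; split => x /=; rewrite in_itv/= andbT.
have mc := cball_borel w (r `^ alpha^-1).
rewrite !probability_setC//; congr (1 - _)%E.
rewrite -(fineK (fin_num_measure mu _ mc)) -(fineK (fin_num_measure nu _ mc)).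
by have := prof (r `^ alpha^-1); rewrite /profile -/(cball _ _) => ->.
Qed.

(** A totally bounded space is bounded, and so is the integrand. *)
Lemma finite_moment_dpow nu : finite_first_moment dpow nu.
Proof.
have [M [M0 HM]] := totally_bounded_bounded tb.
exists point; apply: (@le_lt_trans _ _ (\int[nu]_(x in setT) (M `^ alpha)%:E)%E).
  apply: (@le_integral_off_null _ _ _ nu setT) => //.
  - by rewrite setCT measure0.
  - by move=> x; rewrite lee_fin powR_ge0.
  - by move=> x; rewrite lee_fin powR_ge0.
  - move=> x _; rewrite lee_fin; apply: ge0_ler_powR; rewrite ?nnegrE ?mdist_ge0//.
      exact: ltW.
    exact: ltW.
rewrite integral_cst//; suff : ((M `^ alpha)%:E * nu setT < +oo)%E by [].
by rewrite probability_setT mule1 ltry.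
Qed.

(** Integrating [integral_dpow_eq] over the centres in [S] against [mu] and against
    [nu] identifies the four energies in pairs, so that they cancel. *)
Lemma strong_negative_type_determines mu nu (S : set Omega) :
  strong_negative_type dpow -> measurable (S : set (borel Omega)) ->
  mu (~` S) = 0%E -> nu (~` S) = 0%E ->
  (forall w t, S w -> profile mu w t = profile nu w t) ->
  giry.measure_eq mu nu.
Proof.
move=> [_ sn] mS muS nuS prof; apply: sn; try exact: finite_moment_dpow.
have E (P : probability (borel Omega) R) : P (~` S) = 0%E ->
    energy dpow P mu = energy dpow P nu.
  move=> PS; congr fine; apply: (eq_integral_off_null mS PS).
  - by move=> x; apply: integral_ge0 => y _; rewrite lee_fin powR_ge0.
  - by move=> x; apply: integral_ge0 => y _; rewrite lee_fin powR_ge0.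
  - by move=> x Sx; apply: integral_dpow_eq => t; exact: prof.
by rewrite (E mu)// (E nu)//; lra.
Qed.

End energy.

(** * Concentration of empirical frequencies *)

Definition frequency {R : realType} {T : Type} (n : nat) (x : nat -> T) (A : set T) : R :=
  n%:R^-1 * \sum_(i < n) \1_A (x i).

Section frequency_concentration.
Context (R : realType) d d' (W : measurableType d) (T : measurableType d').
Context (P : probability W R) (mu : probability T R) (X : nat -> {RV P >-> T}).
Hypothesis iidX : iid_with_law X mu.
Variable A : set T.
Hypothesis mA : measurable A.

Let p : R := fine (mu A).
Let B i : set W := X i @^-1` A.

Let muA : mu A = p%:E.
Proof. by rewrite fineK// fin_num_measure. Qed.

Let mB i : measurable (B i).
Proof. by rewrite -[B i]setTI; exact: measurable_funPT. Qed.

Let PB i : P (B i) = p%:E.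
Proof. by rewrite -muA -(iidX.2 i A mA). Qed.

Let PBI i j : i != j -> P (B i `&` B j) = (p * p)%:E.
Proof.
move=> ij; have := iidX.1 [:: i; j] (fun=> A).
rewrite /= inE ij => /(_ isT (fun=> mA)).
rewrite bigcap_seq !big_cons !big_nil setIT mule1 => ->.
by rewrite -/(B i) -/(B j) !PB.
Qed.

Let p_ge0 : 0 <= p. Proof. by rewrite fine_ge0. Qed.

Let p_le1 : p <= 1.
Proof. by rewrite -lee_fin -muA probability_le1. Qed.

Variable n : nat.
Let S w : R := \sum_(i < n) \1_A (X i w).

Let S_ge0 w : 0 <= S w. Proof. by apply: sumr_ge0 => i _; rewrite indicE. Qed.

Let measurable_B (C : set W) : measurable C -> measurable_fun setT (fun w => (\1_C w)%:E : \bar R).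
Proof. by move=> mC; apply/measurable_EFinP; exact: measurable_indic. Qed.

Let measurable_S : measurable_fun setT S.
Proof. by apply: measurable_sum => i; exact: (measurable_indic (mB i)). Qed.

Let integral_S : (\int[P]_w (S w)%:E = (n%:R * p)%:E)%E.
Proof.
under eq_integral do rewrite /S -sumEFin.
rewrite ge0_integral_sum//; last by move=> i; exact: (measurable_B (mB i)).
rewrite (eq_bigr (fun=> p%:E)); last first.
  by move=> i _; rewrite -(PB i) -[B i in RHS]setIT -integral_indic.
by rewrite sumEFin sumr_const card_ord mulr_natl.
Qed.

(* The off-diagonal terms give [p ^+ 2] by independence, and the diagonal terms [p]
   are bounded by [p ^+ 2 + 1]. *)
Let integral_S2 : (\int[P]_w (S w ^+ 2)%:E <= (n%:R ^+ 2 * p ^+ 2 + n%:R)%:E)%E.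
Proof.
have e w : (S w ^+ 2)%:E = (\sum_(i < n) \sum_(j < n) (\1_(B i `&` B j) w)%:E)%E.
  under eq_bigr do rewrite sumEFin.
  rewrite sumEFin expr2 /S mulr_suml; congr EFin; apply: eq_bigr => i _.
  by rewrite mulr_sumr; apply: eq_bigr => j _; rewrite indicI.
under eq_integral do rewrite e.
have m2 (i j : 'I_n) := measurable_B (measurableI _ _ (mB i) (mB j)).
rewrite ge0_integral_sum//; last 2 first.
- by move=> i; apply: emeasurable_sum => j; exact: m2.
- by move=> i w _; apply: sume_ge0 => j _; rewrite lee_fin.
have -> : (n%:R ^+ 2 * p ^+ 2 + n%:R)%:E =
    (\sum_(i < n) (\sum_(j < n) (p ^+ 2 + (i == j)%:R)%:E))%E.
  under eq_bigr do rewrite sumEFin.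
  rewrite sumEFin; congr EFin.
  rewrite (eq_bigr (fun=> n%:R * p ^+ 2 + 1)); last first.
    move=> i _; rewrite big_split /= sumr_const card_ord mulr_natl; congr (_ + _).
    rewrite (bigD1 i)//= eqxx big1 ?addr0// => j ji.
    by rewrite eq_sym (negbTE ji).
  by rewrite sumr_const card_ord -mulr_natl; ring.
apply: lee_sum => i _; rewrite ge0_integral_sum//.
apply: lee_sum => j _; rewrite integral_indic//; last exact: measurableI.
rewrite setIT; have [<-|ij] := eqVneq i j.
  rewrite setIid; apply: (@le_trans _ _ p%:E); first by rewrite -(PB i).
  by rewrite lee_fin (le_trans p_le1)// lerDr sqr_ge0.
by rewrite addr0 expr2 -(PBI ij).
Qed.

Lemma measurable_frequency : measurable_fun setT (fun w => frequency n (fun i => X i w) A : R).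
Proof. by apply: measurable_funM. Qed.

(** Chebyshev's inequality; the variance [n * p * (1 - p)] of the count is bounded
    by [n]. *)
Lemma frequency_tail (e : R) : 0 < e -> (0 < n)%N ->
  (P [set w | (e <= `|frequency n (fun i => X i w) A - p|)%R] <= ((n%:R * e ^+ 2)^-1)%:E)%E.
Proof.
move=> e0 n0; set E := [set w | _].
have n0R : 0 < n%:R :> R by rewrite ltr0n.
pose Z w := (S w - n%:R * p) ^+ 2.
have mZ : measurable_fun setT (fun w => (Z w)%:E).
  apply/measurable_EFinP; apply: measurable_funX; apply: measurable_funB => //.
have EZ w : (e <= `|frequency n (fun i => X i w) A - p|) = ((n%:R * e) ^+ 2 <= Z w).
  rewrite /frequency -/(S w) /Z.
  have -> : n%:R^-1 * S w - p = n%:R^-1 * (S w - n%:R * p).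
    by field; rewrite gt_eqF.
  rewrite normrM normfV (gtr0_norm n0R) -(real_normK (num_real (S w - _))).
  by rewrite ler_pXn2r ?nnegrE ?mulr_ge0// ?(ltW n0R) ?(ltW e0)// ler_pdivlMl.
have EE : E = [set w | (n%:R * e) ^+ 2 <= Z w].
  by apply/seteqP; split => w; rewrite /E /= EZ.
have mE : measurable E.
  rewrite EE -[X in measurable X]setTI.
  have := mZ measurableT `[((n%:R * e) ^+ 2)%:E, +oo[%classic (emeasurable_itv _).
  congr measurable; congr (_ `&` _); apply/seteqP; split => w /=; rewrite in_itv/= andbT lee_fin//.
have IZ : (\int[P]_w (Z w)%:E <= n%:R%:E)%E.
  (* expand the square with all terms kept nonnegative, so that additivity of the
     integral applies without integrability *)
  have c0 : 0 <= 2 * n%:R * p by rewrite !mulr_ge0// ltW.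
  have : (\int[P]_w (Z w)%:E + \int[P]_w ((2 * n%:R * p)%:E * (S w)%:E) =
     \int[P]_w (S w ^+ 2)%:E + \int[P]_w (n%:R ^+ 2 * p ^+ 2)%:E)%E.
    rewrite -!ge0_integralD//.
    - by apply: eq_integral => w _; rewrite -EFinM -!EFinD /Z; congr EFin; ring.
    - by move=> w _; rewrite lee_fin sqr_ge0.
    - by apply/measurable_EFinP; apply: measurable_funX.
    - by move=> w _; rewrite lee_fin mulr_ge0// sqr_ge0.
    - by move=> w _; rewrite lee_fin sqr_ge0.
    - by move=> w _; rewrite -EFinM lee_fin mulr_ge0.
    - by apply: measurable_funeM; apply/measurable_EFinP.
  rewrite ge0_integralZl_EFin//; last first.
  - by apply/measurable_EFinP.
  - by move=> w _; rewrite lee_fin.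
  have -> : (\int[P]_w (n%:R ^+ 2 * p ^+ 2)%:E = (n%:R ^+ 2 * p ^+ 2)%:E)%E.
    by rewrite integral_cst// [X in (_ * X)%E](@probability_setT _ _ _ P) mule1.
  rewrite integral_S.
  move=> h; have := leeD2r (n%:R ^+ 2 * p ^+ 2)%:E integral_S2.
  rewrite -h -!EFinM -!EFinD; case: (\int[P]_w (Z w)%:E)%E => [z| |] //=.
  - by rewrite -EFinD !lee_fin; lra.
  - by move=> _; exact: leNye.
have : (\int[P]_w (((n%:R * e) ^+ 2)%:E * (\1_E w)%:E) <= \int[P]_w (Z w)%:E)%E.
  apply: (@le_integral_off_null _ _ _ P setT) => //.
  - by rewrite setCT measure0.
  - by move=> w; rewrite -EFinM lee_fin mulr_ge0// sqr_ge0.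
  - by move=> w; rewrite lee_fin sqr_ge0.
  - move=> w _; rewrite -EFinM lee_fin indicE.
    have [|_] := boolP (w \in E); last by rewrite mulr0 sqr_ge0.
    by rewrite inE EE mulr1.
rewrite ge0_integralZl_EFin//; last 2 first.
- by apply/measurable_EFinP; exact: measurable_indic.
- by rewrite sqr_ge0.
rewrite integral_indic// setIT => h.
have : (((n%:R * e) ^+ 2)%:E * P E <= n%:R%:E)%E := le_trans h IZ.
have fE : P E \is a fin_num by exact: fin_num_measure.
rewrite -(fineK fE) -EFinM !lee_fin exprMn => h2.
rewrite -[leRHS]mul1r ler_pdivlMr ?mulr_gt0 ?exprn_gt0//.
rewrite -(ler_pM2l n0R) mulr1; apply: le_trans h2.
by rewrite le_eqVlt; apply/orP; left; apply/eqP; ring.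
Qed.

End frequency_concentration.

(** * Divergence in outer probability from vanishing events *)

Section vanishing_events.
Context (R : realType) d (W : measurableType d) (P : probability W R).

Definition vanishing (E : nat -> set W) : Prop :=
  (forall n, measurable (E n)) /\ P (E n) @[n --> \oo] --> 0%E.

Lemma vanishingU E F : vanishing E -> vanishing F ->
  vanishing (fun n => E n `|` F n).
Proof.
move=> [mE E0] [mF F0]; split=> [n|]; first exact: measurableU.
apply: (@squeeze_cvge _ _ _ _ (fun=> 0%E) _ (fun n => P (E n) + P (F n))%E).
- by apply: nearW => n; rewrite measure_ge0 /=; exact: measureU2.
- exact: cvg_cst.
- by rewrite -[0%E]adde0; apply: cvgeD.
Qed.

(** The statistics need not be measurable, but the events that cover their sublevel
    sets are, so their outer probability is a probability. *)
Lemma diverges_of_vanishing (Y : nat -> W -> \bar R) :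
  (forall K : R, exists2 E, vanishing E &
     \forall n \near \oo, [set w | (Y n w <= K%:E)%E] `<=` E n) ->
  diverges_in_outer_probability P Y.
Proof.
move=> h K; have [E [mE E0] YE] := h K.
apply: (@squeeze_cvge _ _ _ _ (fun=> 0%E) _ (fun n => P (E n))) => //; last exact: cvg_cst.
near=> n; rewrite mu_ext_ge0 /=.
have -> : P (E n) = (P^*)%mu (E n) by rewrite measurable_mu_extE.
by apply: le_mu_ext; near: n.
Unshelve. all: by end_near. Qed.

Context d' (T : measurableType d') (mu : probability T R) (X : nat -> {RV P >-> T}).

Lemma vanishing_frequency (A : set T) (e : R) : iid_with_law X mu -> measurable A ->
  0 < e ->
  vanishing (fun n => [set w | e <= `|frequency n (fun i => X i w) A - fine (mu A)|]).
Proof.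
move=> iidX mA e0; split=> [n|].
  have m : measurable_fun setT (fun w => `|frequency n (fun i => X i w) A - fine (mu A)|).
    apply: measurableT_comp => //; apply: measurable_funB => //.
    exact: measurable_frequency.
  have := m measurableT `[e, +oo[%classic (measurable_itv _).
  rewrite setTI; congr measurable; apply/seteqP; split => w /=;
  by rewrite in_itv /= andbT.
apply: (@squeeze_cvge _ _ _ _ (fun=> 0%E) _ (fun n => ((n%:R * e ^+ 2)^-1)%:E)).
- near=> n; rewrite measure_ge0 /=; apply: (frequency_tail iidX mA e0).
  by near: n; exists 1%N.
- exact: cvg_cst.
- apply: cvg_EFin; first exact: nearW.
  rewrite -cvg_shiftS.
  have c : (fun n => harmonic n * (e ^+ 2)^-1) @ \oo --> 0 * (e ^+ 2)^-1.
    by apply: cvgM; [exact: cvg_harmonic|exact: cvg_cst].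
  rewrite mul0r in c; apply: cvg_trans c; apply: near_eq_cvg.
  by apply: nearW => n /=; rewrite [RHS]invfM.
Unshelve. all: by end_near. Qed.

End vanishing_events.

(** * A lower bound for the Cramer-von Mises statistic *)

Section empirical.
Context (R : realType) (Omega : pmetricType R).
Implicit Types (x : nat -> Omega) (w : Omega) (t : R).

Lemma empirical_profileE n x w t : empirical_profile n x w t = frequency n x (cball w t).
Proof.
rewrite /empirical_profile /frequency; congr (_ * _); apply: eq_bigr => i _.
by rewrite indicE; congr ((_ : bool)%:R); apply/idP/idP; rewrite inE.
Qed.

Lemma frequency_mono (T : Type) n (x : nat -> T) (A B : set T) : A `<=` B ->
  frequency n x A <= frequency n x B :> R.
Proof.
move=> AB; rewrite ler_wpM2l ?invr_ge0//; apply: ler_sum => i _.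
rewrite !indicE ler_nat; have [|//] := boolP (x i \in A).
by rewrite inE => /AB /mem_set ->.
Qed.

Lemma frequency_ge0 (T : Type) n (x : nat -> T) (A : set T) : 0 <= frequency n x A :> R.
Proof. by rewrite mulr_ge0 ?invr_ge0//; apply: sumr_ge0 => i _; rewrite indicE. Qed.

Lemma empirical_measureE d (T : measurableType d) n (x : nat -> T) (A : set T) :
  empirical_measure n x A = (frequency n x A : R)%:E.
Proof.
rewrite /empirical_measure /= /mscale /= /msum /frequency EFinM -sumEFin.
by congr (_ * _)%E.
Qed.

Lemma ge_integral_on_subset d (T : measurableType d) (m : {measure set T -> \bar R})
    (D B : set T) (f : T -> \bar R) (c : R) :
  measurable B -> B `<=` D -> 0 <= c ->
  (forall y, D y -> (0 <= f y)%E) -> (forall y, B y -> (c%:E <= f y)%E) ->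
  (c%:E * m B <= \int[m]_(y in D) f y)%E.
Proof.
move=> mB BD c0 f0 cf.
have -> : (c%:E * m B = \int[m]_y (c%:E * (\1_B y)%:E))%E.
  rewrite ge0_integralZl_EFin//.
  - by rewrite integral_indic// setIT.
  - by apply/measurable_EFinP; exact: measurable_indic.
rewrite [leRHS]integral_mkcond.
apply: (@le_integral_off_null _ _ _ m setT) => //.
- by rewrite setCT measure0.
- by move=> y; rewrite -EFinM lee_fin mulr_ge0.
- by move=> y; rewrite patchE; case: ifPn => // yD; apply: f0; exact: set_mem.
- move=> y _; rewrite -EFinM indicE; have [yB|yB] := boolP (y \in B).
    have By := set_mem yB.
    by rewrite mulr1 patchE ifT; [exact: cf|apply: mem_set; exact: BD].
  by rewrite mulr0 patchE; case: ifPn => // yD; apply: f0; exact: set_mem.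
Qed.

(** If the profiles differ by at least [e] near [(w0, t0)], every sample point [w] within
    [eta / 2] of [w0] sees each sample point of the shell of radius [t0] and width
    [eta / 2] at a distance within [eta] of [t0], where the squared process is
    at least [n * e ^+ 2]. *)
Lemma T_CM_lower_bound (mu0 : probability (borel Omega) R) n x w0 t0 eta e :
  0 < eta -> 0 <= e ->
  (forall w t, mdist w0 w < eta -> `|t - t0| < eta ->
     e <= `|empirical_profile n x w t - profile mu0 w t|) ->
  ((n%:R * e ^+ 2 * frequency n x [set y | `|mdist w0 y - t0| < eta / 2]
     * frequency n x (ball w0 (eta / 2)))%:E <= T_CM mu0 n x)%E.
Proof.
move=> eta0 e0 sep; set S := [set y | _].
have inner w : ball w0 (eta / 2) w -> ((n%:R * e ^+ 2 * frequency n x S)%:E <=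
   \int[@empirical_measure R _ (measurableTypeR R) n (fun i => mdist w (x i))]_(t in `[0%R, +oo[)
      (empirical_process mu0 n x w t ^+ 2)%:E)%E.
  move=> /ball_mdistP w0w.
  pose B : set (measurableTypeR R) := `]t0 - eta, t0 + eta[%classic `&` `[0, +oo[%classic.
  have mB : measurable B by apply: measurableI; exact: measurable_itv.
  apply: (@le_trans _ _ ((n%:R * e ^+ 2)%:E *
     @empirical_measure R _ (measurableTypeR R) n (fun i => mdist w (x i)) B)%E).
    rewrite empirical_measureE -EFinM lee_fin ler_wpM2l ?mulr_ge0 ?sqr_ge0//.
    rewrite ler_wpM2l ?invr_ge0//; apply: ler_sum => i _.
    rewrite !indicE ler_nat; have [xS|//] := boolP (x i \in S).
    rewrite mem_set//; split; rewrite /= in_itv /= ?mdist_ge0//.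
    move: xS; rewrite inE /S /= ltr_norml => /andP[h1 h2].
    have := metric_triangle w w0 (x i); have := metric_triangle w0 w (x i).
    by rewrite (metric_sym w w0) => h3 h4; apply/andP; split; lra.
  apply: ge_integral_on_subset => //.
  - by move=> y [].
  - by rewrite mulr_ge0 ?sqr_ge0.
  - by move=> y _; rewrite lee_fin sqr_ge0.
  - move=> t [+ _]; rewrite /= in_itv /= => /andP[h1 h2].
    rewrite lee_fin /empirical_process exprMn sqr_sqrtr// ler_wpM2l//.
    rewrite -(real_normK (num_real (_ - _))) ler_pXn2r ?nnegrE//; apply: sep; first lra.
    by rewrite ltr_norml; apply/andP; split; lra.
have := @ge_integral_on_subset _ _ (@empirical_measure R _ (borel Omega) n x) setT
  (ball w0 (eta / 2)) _ _ (ball_borel _ _) (fun _ _ => I) _ _ inner.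
rewrite empirical_measureE -EFinM; apply.
- apply: mulr_ge0; last exact: frequency_ge0.
  by rewrite mulr_ge0 ?sqr_ge0.
- by move=> w _; apply: integral_ge0 => t _; rewrite lee_fin sqr_ge0.
Qed.

End empirical.

(** * Regularity of profiles *)

Section profiles.
Context (R : realType) (Omega : pmetricType R).
Implicit Types (nu : probability (borel Omega) R) (w : Omega) (r s t : R).

Lemma cball_shift w w' r s : mdist w w' + r <= s -> cball w r `<=` cball w' s.
Proof.
move=> h y; rewrite /cball /= => wy.
have := metric_triangle w' w y; rewrite (metric_sym w' w); lra.
Qed.

Lemma profile_le nu w w' r s : cball w r `<=` cball w' s -> profile nu w r <= profile nu w' s.
Proof. by move=> h; apply: fine_measure_le => //; exact: cball_borel. Qed.

Lemma profile_mono nu w r s : r <= s -> profile nu w r <= profile nu w s.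
Proof. by move=> rs; apply: profile_le; apply: cball_shift; rewrite mdistxx add0r. Qed.

Lemma profile_ge0 nu w r : 0 <= profile nu w r.
Proof. by rewrite fine_ge0. Qed.

Lemma profile_le1 nu w r : profile nu w r <= 1.
Proof.
rewrite -lee_fin fineK; last by apply: fin_num_measure; exact: cball_borel.
by apply: probability_le1; exact: cball_borel.
Qed.

Lemma profile_neg nu w r : r < 0 -> profile nu w r = 0.
Proof.
move=> r0; rewrite /profile (_ : [set x | _] = set0) ?measure0//.
apply/seteqP; split => x //=; have := mdist_ge0 w x; lra.
Qed.

Definition uniformly_lipschitz nu (K : R) : Prop :=
  forall w r s, `|profile nu w r - profile nu w s| <= K * `|r - s|.

(** The profile vanishes on negative radii, so the Lipschitz bound extends to the
    real line exactly when the profile vanishes at [0], that is when there are no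
    atoms.  An atom at [w] would be a jump of the profile centred at any other
    point [w'], at the positive radius [mdist w' w]; in a one-point space there is no such
    [w'], and the extension fails. *)
Lemma lipschitz_profile_real nu (a b : Omega) : a != b -> lipschitz_profile nu ->
  exists2 K, 0 < K & uniformly_lipschitz nu K.
Proof.
move=> ab [K [K0 HK]]; exists K => //.
have lip w r s : 0 <= r -> 0 <= s -> `|profile nu w r - profile nu w s| <= K * `|r - s|.
  move=> r0 s0; rewrite -lee_fin; apply: le_trans (HK r s r0 s0).
  by apply: ereal_sup_ubound; exists w.
have atom w : profile nu w 0 = 0.
  have [w' ww'] : exists w', 0 < mdist w' w.
    have [aw|aw] := eqVneq a w; last by exists a; rewrite mdist_gt0.
    by exists b; rewrite mdist_gt0 -aw eq_sym.
  apply/eqP; rewrite eq_le profile_ge0 andbT leNgt; apply/negP => p0.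
  pose s := Num.min (mdist w' w) (profile nu w 0 / (2 * K)).
  have s0 : 0 < s by rewrite lt_min ww' divr_gt0// mulr_gt0.
  have sD : s <= mdist w' w by rewrite ge_min lexx.
  have sK : K * s <= profile nu w 0 / 2.
    have : s <= profile nu w 0 / (2 * K) by rewrite ge_min lexx orbT.
    rewrite ler_pdivlMr ?mulr_gt0//; lra.
  have := lip w' (mdist w' w) (mdist w' w - s) (mdist_ge0 _ _).
  rewrite subr_ge0 => /(_ sD).
  have -> : mdist w' w - (mdist w' w - s) = s by lra.
  rewrite (gtr0_norm s0) => /(le_trans (ler_norm _)).
  set D := mdist w' w.
  have mD := cball_borel w' D; have mDs := cball_borel w' (D - s).
  have : profile nu w 0 <= fine (nu (cball w' D `\` cball w' (D - s))).
    apply: fine_measure_le; [exact: cball_borel|exact: measurableD|].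
    move=> y; rewrite /cball /= => y0.
    have <- : w = y by apply: mdist_positivity; apply/eqP; rewrite eq_le y0 mdist_ge0.
    rewrite -/D; split; [exact: lexx|apply/negP; rewrite -ltNge; lra].
  rewrite fine_measureD//; last by apply: cball_shift; rewrite mdistxx; lra.
  rewrite -/(profile nu w' D) -/(profile nu w' (D - s)); lra.
have max0 w r : profile nu w r = profile nu w (Num.max r 0).
  by have [r0|r0] := leP 0 r; rewrite // profile_neg// atom.
move=> w r s; rewrite (max0 w r) (max0 w s).
apply: le_trans (lip w _ _ _ _) _; rewrite ?le_max ?lexx ?orbT//.
rewrite ler_pM2l//.
have [r0|r0] := leP 0 r; have [s0|s0] := leP 0 s => //.
- rewrite subr0 (ger0_norm r0); apply: le_trans (ler_norm _); lra.
- rewrite sub0r normrN (ger0_norm s0) distrC; apply: le_trans (ler_norm _); lra.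
- by rewrite subrr normr0.
Qed.

Definition shell w t (e : R) : set Omega := [set y | `|mdist w y - t| < e].

Lemma shell_borel w t e : measurable (shell w t e : set (borel Omega)).
Proof.
have -> : shell w t e = ball w (t + e) `\` cball w (t - e).
  apply/seteqP; split => y; rewrite /shell /cball /= ltr_norml.
    move=> /andP[h1 h2]; split; first by apply/ball_mdistP; lra.
    by apply/negP; rewrite -ltNge; lra.
  move=> [/ball_mdistP h1 /negP]; rewrite -ltNge => h2; apply/andP; split; lra.
by apply: measurableD; [exact: ball_borel|exact: cball_borel].
Qed.

Lemma profile_lt_shell nu w t e r s : r <= s -> t - e <= r -> s < t + e ->
  profile nu w r < profile nu w s -> 0 < fine (nu (shell w t e)).
Proof.
move=> rs tr st; rewrite -subr_gt0 => h; apply: lt_le_trans h _.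
have ms := cball_borel w s; have mr := cball_borel w r.
rewrite -fine_measureD//; last by apply: cball_shift; rewrite mdistxx add0r.
apply: fine_measure_le; [exact: measurableD|exact: shell_borel|].
move=> y [] /= h1 /negP; rewrite -ltNge => h2; rewrite /shell /= ltr_norml; apply/andP; split; lra.
Qed.

(** If [G t] exceeds [H t], move left to the infimum [t0] of the radii [s] with
    [G t <= G s]: then [G t0 = G t] by continuity, while [H] can only decrease, and [G] increases
    strictly just before [t0].  In the opposite case move right to the supremum of
    the radii [s] with [G s <= G t], just after which [G] increases strictly. *)
Lemma charged_gap mu nu K w t : totally_bounded Omega -> 0 < K ->
  uniformly_lipschitz mu K -> profile mu w t <> profile nu w t ->
  exists t0, profile mu w t0 <> profile nu w t0 /\
    forall e, 0 < e -> 0 < fine (mu (shell w t0 e)).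
Proof.
move=> tb K0 lip neq.
set G := profile mu w in neq *; set H := profile nu w in neq *.
have Glip r s : r <= s -> G s <= G r + K * (s - r).
  move=> rs; have := lip w s r; rewrite (ger0_norm (_ : 0 <= s - r)) ?subr_ge0//.
  by move=> /(le_trans (ler_norm _)); rewrite -/(G s) -/(G r); lra.
have Gm r s : r <= s -> G r <= G s by exact: profile_mono.
have Hm r s : r <= s -> H r <= H s by exact: profile_mono.
have [gt|le] := ltP (H t) (G t).
- pose E := [set s | G t <= G s].
  have E0 s : E s -> 0 <= s.
    rewrite /E /= => ts; rewrite leNgt; apply/negP => s0.
    have : G s = 0 by exact: profile_neg.
    have : 0 <= H t by exact: profile_ge0.
    lra.
  have Ei : has_inf E by split; [exists t; exact: lexx|exists 0 => s; exact: E0].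
  pose t0 := inf E.
  have t0t : t0 <= t by apply: ge_inf; [exact: Ei.2|exact: lexx].
  have Gt0 : G t <= G t0.
    rewrite leNgt; apply/negP => lt.
    have c0 : 0 < (G t - G t0) / K by rewrite divr_gt0// subr_gt0.
    have [s Es st] := inf_adherent c0 Ei.
    have := Glip _ _ (ge_inf Ei.2 Es); rewrite -/t0.
    have : K * (s - t0) < G t - G t0.
      by rewrite mulrC -ltr_pdivlMr//; move: st; rewrite -/t0; lra.
    move: Es; rewrite /E /=; lra.
  exists t0; split; first by have := Hm _ _ t0t; lra.
  move=> e e0; apply: (@profile_lt_shell _ _ _ _ (t0 - e / 2) t0); try lra.
  apply: lt_le_trans Gt0; rewrite ltNge; apply/negP => h.
  have := ge_inf Ei.2 h; rewrite -/t0; lra.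
- have {le}lt : G t < H t by rewrite lt_neqAle le andbT; apply/eqP.
  pose E := [set s | G s <= G t].
  have [M [M0 HM]] := totally_bounded_bounded tb.
  have GM : G M = 1.
    rewrite /G /profile (_ : [set x | _] = setT) ?probability_setT//.
    by apply/seteqP; split => x //= _; exact: HM.
  have EM s : E s -> s <= M.
    rewrite /E /= => ts; rewrite leNgt; apply/negP => s0.
    have := Gm _ _ (ltW s0); have : H t <= 1 by exact: profile_le1.
    lra.
  have Es : has_sup E by split; [exists t; exact: lexx|exists M => s; exact: EM].
  pose t0 := sup E.
  have t0t : t <= t0 by apply: ub_le_sup; [exact: Es.2|exact: lexx].
  have Gt0 : G t0 <= G t.
    rewrite leNgt; apply/negP => gt.
    have c0 : 0 < (G t0 - G t) / K by rewrite divr_gt0// subr_gt0.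
    have [s Ess st] := sup_adherent c0 Es.
    have := Glip _ _ (ub_le_sup Es.2 Ess); rewrite -/t0.
    have : K * (t0 - s) < G t0 - G t.
      by rewrite mulrC -ltr_pdivlMr//; move: st; rewrite -/t0; lra.
    move: Ess; rewrite /E /=; lra.
  exists t0; split; first by have := Hm _ _ t0t; lra.
  move=> e e0; apply: (@profile_lt_shell _ _ _ _ t0 (t0 + e / 2)); try lra.
  apply: (le_lt_trans Gt0); rewrite ltNge; apply/negP => h.
  have := ub_le_sup Es.2 h; rewrite -/t0; lra.
Qed.

End profiles.

(** * Divergence of the two statistics *)

Section divergence.
Context (R : realType) (Omega : pmetricType R) (mu mu0 : probability (borel Omega) R).
Context d (W : measurableType d) (P : probability W R) (X : nat -> {RV P >-> borel Omega}).
Hypothesis iidX : iid_with_law X mu.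

Let sample w i : Omega := X i w.

Lemma vanishing_empirical_profile w0 t0 e : 0 < e ->
  vanishing P (fun n => [set w | e <= `|empirical_profile n (sample w) w0 t0 - profile mu w0 t0|]).
Proof.
move=> e0; have := vanishing_frequency iidX (cball_borel w0 t0) e0.
congr vanishing; apply/funext => n; apply/seteqP.
by split => w; rewrite /= empirical_profileE.
Qed.

Lemma T_KS_diverges w0 t0 : 0 <= t0 -> profile mu w0 t0 <> profile mu0 w0 t0 ->
  diverges_in_outer_probability P (fun n w => T_KS mu0 n (sample w)).
Proof.
move=> t00 neq; apply: diverges_of_vanishing => K.
pose e := `|profile mu w0 t0 - profile mu0 w0 t0| / 2.
have e0 : 0 < e by rewrite divr_gt0// normr_gt0 subr_eq0; apply/eqP.
exists (fun n => [set w | e <= `|empirical_profile n (sample w) w0 t0 - profile mu w0 t0|]).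
  exact: vanishing_empirical_profile.
near=> n; move=> w /= TK; rewrite leNgt; apply/negP => close.
set F := empirical_profile _ _ _ _ in close.
have far : e <= `|F - profile mu0 w0 t0|.
  have := ler_distD F (profile mu w0 t0) (profile mu0 w0 t0).
  rewrite (distrC (profile mu w0 t0) F).
  have -> : `|profile mu w0 t0 - profile mu0 w0 t0| = e + e by rewrite /e; lra.
  lra.
have nK : (K / e) ^+ 2 < n%:R by near: n; exact: nbhs_infty_gtr.
have sqK : K < Num.sqrt n%:R * e.
  rewrite -ltr_pdivrMr//; apply: le_lt_trans (ler_norm _) _.
  by rewrite -sqrtr_sqr ltr_sqrt// (le_lt_trans _ nK)// sqr_ge0.
have : (`|empirical_process mu0 n (sample w) w0 t0|%:E <= K%:E)%E.
  by apply: le_trans TK; apply: ereal_sup_ubound; exists (w0, t0).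
rewrite lee_fin /empirical_process normrM (ger0_norm (sqrtr_ge0 _)) -/F.
have := ler_wpM2l (sqrtr_ge0 (n%:R : R)) far; lra.
Unshelve. all: by end_near. Qed.

(** For [w] and [t] within [eta] of [w0] and [t0], the closed ball of radius [t]
    around [w] is squeezed between those of radii [t0 - 2 * eta] and
    [t0 + 2 * eta] around [w0].  A single deviation bound at radius
    [s = t0 - 2 * eta] (or [t0 + 2 * eta], according to the sign of the gap) thus
    controls the empirical profile on the whole window, and the Lipschitz bounds
    make the two shifts cost at most half of the gap. *)
Lemma separation_window w0 t0 (K K0 : R) : 0 < K -> 0 < K0 ->
  uniformly_lipschitz mu K -> uniformly_lipschitz mu0 K0 ->
  profile mu w0 t0 <> profile mu0 w0 t0 ->
  exists eta e s : R, [/\ 0 < eta, 0 < e & forall n (x : nat -> Omega),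
    `|empirical_profile n x w0 s - profile mu w0 s| < e ->
    forall w t, mdist w0 w < eta -> `|t - t0| < eta ->
      e <= `|empirical_profile n x w t - profile mu0 w t|].
Proof.
move=> Kp K0p lip lip0 neq.
pose e := `|profile mu w0 t0 - profile mu0 w0 t0| / 4.
have e0 : 0 < e by rewrite divr_gt0// normr_gt0 subr_eq0; apply/eqP.
(* the shifts by [2 * eta] cost [2 * e] together, out of a gap of [4 * e] *)
pose eta := e / (K + K0).
have KK : 0 < K + K0 by rewrite addr_gt0.
have eta0 : 0 < eta by rewrite divr_gt0.
have eta2 : 0 < 2 * eta by lra.
have etaK : K * eta + K0 * eta = e by rewrite -mulrDl /eta mulrC divfK// gt_eqF.
have emp_le n (x : nat -> Omega) w w' r s : cball w r `<=` cball w' s ->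
    empirical_profile n x w r <= empirical_profile n x w' s.
  by move=> h; rewrite !empirical_profileE; exact: frequency_mono.
have [gt|le_pr] := ltP (profile mu0 w0 t0) (profile mu w0 t0).
- exists eta, e, (t0 - 2 * eta); split => // n x close w t w0w.
  rewrite ltr_norml => /andP[h1 h2].
  have c1 : empirical_profile n x w0 (t0 - 2 * eta) <= empirical_profile n x w t.
    by apply: emp_le; apply: cball_shift; lra.
  have c2 : profile mu0 w t <= profile mu0 w0 (t0 + 2 * eta).
    by apply: profile_le; apply: cball_shift; rewrite (metric_sym w w0); lra.
  have := lip w0 t0 (t0 - 2 * eta).
  have -> : t0 - (t0 - 2 * eta) = 2 * eta by lra.
  have := lip0 w0 (t0 + 2 * eta) t0.
  have -> : t0 + 2 * eta - t0 = 2 * eta by lra.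
  rewrite (gtr0_norm eta2).
  move=> /(le_trans (ler_norm _)) b1 /(le_trans (ler_norm _)) b2.
  have E4 : profile mu w0 t0 - profile mu0 w0 t0 = 4 * e.
    by rewrite /e (gtr0_norm (_ : 0 < _ - _)) ?subr_gt0//; lra.
  apply: le_trans (ler_norm _).
  move: close; rewrite ltr_norml => /andP[b3 b4]; lra.
- have lt : profile mu w0 t0 < profile mu0 w0 t0.
    by rewrite lt_neqAle le_pr andbT; apply/eqP.
  exists eta, e, (t0 + 2 * eta); split => // n x close w t w0w.
  rewrite ltr_norml => /andP[h1 h2].
  have c1 : empirical_profile n x w t <= empirical_profile n x w0 (t0 + 2 * eta).
    by apply: emp_le; apply: cball_shift; rewrite (metric_sym w w0); lra.
  have c2 : profile mu0 w0 (t0 - 2 * eta) <= profile mu0 w t.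
    by apply: profile_le; apply: cball_shift; lra.
  have := lip0 w0 t0 (t0 - 2 * eta).
  have -> : t0 - (t0 - 2 * eta) = 2 * eta by lra.
  have := lip w0 (t0 + 2 * eta) t0.
  have -> : t0 + 2 * eta - t0 = 2 * eta by lra.
  rewrite (gtr0_norm eta2).
  move=> /(le_trans (ler_norm _)) b1 /(le_trans (ler_norm _)) b2.
  have E4 : profile mu0 w0 t0 - profile mu w0 t0 = 4 * e.
    by rewrite /e distrC (gtr0_norm (_ : 0 < _ - _)) ?subr_gt0//; lra.
  rewrite distrC; apply: le_trans (ler_norm _).
  move: close; rewrite ltr_norml => /andP[b3 b4]; lra.
Qed.

Lemma T_CM_diverges w0 t0 (K K0 : R) : 0 < K -> 0 < K0 ->
  uniformly_lipschitz mu K -> uniformly_lipschitz mu0 K0 ->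
  profile mu w0 t0 <> profile mu0 w0 t0 ->
  supp mu w0 -> (forall e, 0 < e -> 0 < fine (mu (shell w0 t0 e))) ->
  diverges_in_outer_probability P (fun n w => T_CM mu0 n (sample w)).
Proof.
move=> Kp K0p lip lip0 neq sw0 charged; apply: diverges_of_vanishing => C.
have [eta [e [s [eta0 e0 sep]]]] := separation_window Kp K0p lip lip0 neq.
have eta2 : 0 < eta / 2 by rewrite divr_gt0.
have mS := shell_borel w0 t0 (eta / 2); have mB := ball_borel w0 (eta / 2).
pose a := fine (mu (shell w0 t0 (eta / 2))).
pose b := fine (mu (ball w0 (eta / 2))).
have a0 : 0 < a by exact: charged.
have b0 : 0 < b.
  rewrite fine_gt0// (supp_open sw0 (open_metric_ball _ _)) /=.
    by rewrite ltey_eq fin_num_measure.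
  by apply/ball_mdistP; rewrite mdistxx.
pose E1 n := [set w | e <= `|empirical_profile n (sample w) w0 s - profile mu w0 s|].
pose E2 n := [set w | a / 2 <= `|frequency n (sample w) (shell w0 t0 (eta / 2)) - a|].
pose E3 n := [set w | b / 2 <= `|frequency n (sample w) (ball w0 (eta / 2)) - b|].
exists (fun n => E1 n `|` E2 n `|` E3 n).
  apply: vanishingU; [apply: vanishingU|].
  - exact: vanishing_empirical_profile.
  - by apply: (vanishing_frequency iidX mS); rewrite divr_gt0.
  - by apply: (vanishing_frequency iidX mB); rewrite divr_gt0.
have c0 : 0 < e ^+ 2 * (a / 2) * (b / 2) by rewrite !mulr_gt0// exprn_gt0.
near=> n; move=> w /= TC; apply: contrapT => /not_orP[/not_orP[h1 h2] h3].
have {}h1 : `|empirical_profile n (sample w) w0 s - profile mu w0 s| < e.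
  by rewrite ltNge; apply/negP.
have {}h2 : a / 2 <= frequency n (sample w) (shell w0 t0 (eta / 2)).
  rewrite leNgt; apply/negP => h; apply: h2; rewrite /E2 /= distrC.
  apply: le_trans (ler_norm _); lra.
have {}h3 : b / 2 <= frequency n (sample w) (ball w0 (eta / 2)).
  rewrite leNgt; apply/negP => h; apply: h3; rewrite /E3 /= distrC.
  apply: le_trans (ler_norm _); lra.
have := le_trans (T_CM_lower_bound eta0 (ltW e0) (sep n (sample w) h1)) TC.
rewrite lee_fin -/(shell w0 t0 (eta / 2)) leNgt => /negP; apply.
have nC : C / (e ^+ 2 * (a / 2) * (b / 2)) < n%:R.
  by near: n; exact: nbhs_infty_gtr.
move: nC; rewrite ltr_pdivrMr// => /lt_le_trans; apply.
have ab : a / 2 * (b / 2) <= frequency n (sample w) (shell w0 t0 (eta / 2)) *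
    frequency n (sample w) (ball w0 (eta / 2)) by apply: ler_pM => //; lra.
have := ler_wpM2l (mulr_ge0 (ler0n R n) (sqr_ge0 e)) ab.
by rewrite !mulrA.
Unshelve. all: by end_near. Qed.

End divergence.

Theorem theorem5p1 (R : realType) (Omega : pmetricType R)
    (mu0 mu : probability (borel Omega) R)
    (dW : measure_display) (W : measurableType dW) (P : probability W R)
    (X : nat -> {RV P >-> borel Omega}) :
  separable Omega ->
  entropy_condition Omega ->
  lipschitz_profile mu -> lipschitz_profile mu0 ->
  some_power_strong_negative_type Omega \/ (doubling mu /\ doubling mu0) ->
  iid_with_law X mu ->
  ~ giry.measure_eq mu mu0 ->
  diverges_in_outer_probability P (fun n w => T_KS mu0 n (fun i => X i w)) /\
  ((doubling mu /\ doubling mu0) \/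
   (some_power_strong_negative_type Omega /\ supp mu0 `<=` supp mu) ->
   diverges_in_outer_probability P (fun n w => T_CM mu0 n (fun i => X i w))).
Proof.
move=> _ /entropy_totally_bounded tb lipmu lipmu0 H iidX neq; split.
- have [w0 [t0 d0]] : exists w t, profile mu w t <> profile mu0 w t.
    apply: contrapT => h; apply: neq.
    have same w t : profile mu w t = profile mu0 w t.
      by apply: contrapT => h'; apply: h; exists w, t.
    case: H => [[alpha [alpha0 sn]]|[dm _]].
      apply: (@strong_negative_type_determines _ _ tb _ alpha0 _ _ setT) => //.
      + by rewrite setCT measure0.
      + by rewrite setCT measure0.
    exact: doubling_determines.
  apply: (T_KS_diverges iidX _ d0).
  rewrite leNgt; apply/negP => t0neg; apply: d0.
  by rewrite !profile_neg.
- move=> H'.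
  (* in a one-point space all probability measures coincide *)
  have [a [b ab]] : exists a b : Omega, a != b.
    apply: contrapT => h; apply: neq => A _.
    have all_eq (x y : Omega) : x = y.
      by apply: contrapT => /eqP xy; apply: h; exists x, y.
    have [Ap|Ap] := pselect (A point).
      have -> : A = setT by apply/seteqP; split => // x _; rewrite (all_eq x point).
      have : mu setT = mu0 setT by rewrite !probability_setT.
      by [].
    have -> : A = set0 by apply/seteqP; split => // x; rewrite (all_eq x point).
    by rewrite !measure0.
  have [K Kp lip] := lipschitz_profile_real ab lipmu.
  have [K0 K0p lip0] := lipschitz_profile_real ab lipmu0.
  have [w0 [t [sw0 d0]]] : exists w t, supp mu w /\ profile mu w t <> profile mu0 w t.
    apply: contrapT => h; apply: neq.
    have same w t : supp mu w -> profile mu w t = profile mu0 w t.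
      by move=> sw; apply: contrapT => h'; apply: h; exists w, t.
    case: H' => [[dm _]|[[alpha [alpha0 sn]] sub]].
      exact: doubling_determines.
    apply: (@strong_negative_type_determines _ _ tb _ alpha0 _ _ (supp mu)) => //.
    + exact: supp_borel.
    + exact: measure_setC_supp.
    + apply: (subset_measure0 _ _ _ (measure_setC_supp mu0 tb)).
      * by apply: measurableC; exact: supp_borel.
      * by apply: measurableC; exact: supp_borel.
      * exact: subsetC.
  have [t0 [d1 charged]] := charged_gap tb Kp lip d0.
  exact: (T_CM_diverges iidX Kp K0p lip lip0 d1 sw0 charged).
Qed.
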